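(* Let $d=4$. Every non-degenerate system of Monge–Ampère type is ${\bf SL}(6)$-equivalent to one of the following normal forms: 1. $u_2-v_1=0,\ \ u_3+v_4=0$; 2. $u_2-v_1=0,\ \ u_3+v_4+u_1v_2-u_2v_1=0$; 3. $u_2-v_1=0,\ \ u_3v_4-u_4v_3-1=0$; 4. $u_2-v_1=0,\ \ u_1+v_2+u_3v_4-u_4v_3=0$.
   Context: All objects are complex (locally analytic). Let $u(\mathbf x),v(\mathbf x)$ be functions of $\mathbf x=(x^1,\dots,x^d)$, with $u_i=\partial u/\partial x^i$, $v_i=\partial v/\partial x^i$. Let $V=\mathbb{C}^{d+2}$ with coordinates $(x^1,\dots,x^d,u,v)$. A system of Monge–Ampère type is a pair of linearly independent equations $$a^{ij}(u_iv_j-u_jv_i)+b^iu_i+c^iv_i+m=0,\qquad \alpha^{ij}(u_iv_j-u_jv_i)+\beta^iu_i+\gamma^iv_i+\mu=0$$ with constant coefficients. Geometrically the tangent $d$-planes of graphs $u=u(\mathbf x),v=v(\mathbf x)$ are points of ${\bf Gr}(d,V)$ and the system defines a codimension-two submanifold $X\subset{\bf Gr}(d,V)$ (a linear section of its Plücker embedding); solutions are $d$-dimensional submanifolds of $V$ whose tangent spaces lie in $X$. Two systems are ${\bf SL}(d+2)$-equivalent if an element of ${\bf SL}(V)$ (linear change of the coordinates $(x,u,v)$), acting on ${\bf Gr}(d,V)$, maps the $X$ of one to the $X$ of the other. A system $F=G=0$ is non-degenerate if its characteristic variety $\det\big[\sum_{i=1}^d p_i\begin{pmatrix}F_{u_i}&F_{v_i}\\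 G_{u_i}&G_{v_i}\end{pmatrix}\big]=0$ is an irreducible quadric in $p_1,\dots,p_d$ of rank $d$ when $d\le4$ and of rank $4$ when $d>4$. *)

(* Defs.v *)
From HB Require Import structures.
From mathcomp Require Import all_boot all_order all_algebra.
Set Implicit Arguments. Unset Strict Implicit. Unset Printing Implicit Defensive.
Import Order.TTheory GRing.Theory Num.Theory.
Local Open Scope ring_scope.

(* One equation  a^{ij}(u_i v_j - u_j v_i) + b^i u_i + c^i v_i + m = 0
   (indices 1..4 of the paper are 0..3 here; sum over all i, j). *)
Record MAeq (C : Type) := MAEq {
  ma_a : 'I_4 -> 'I_4 -> C; ma_b : 'I_4 -> C; ma_c : 'I_4 -> C; ma_m : C }.

Record MAsys (C : Type) := MASys { sysF : MAeq C; sysG : MAeq C }.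

Section MA.
Variable C : fieldType.

Definition aeval (E : MAeq C) (u v : 'I_4 -> C) : C :=
  \sum_i \sum_j ma_a E i j * (u i * v j - u j * v i)
  + \sum_i ma_b E i * u i + \sum_i ma_c E i * v i + ma_m E.

Definition lin_indep (S : MAsys C) : Prop :=
  forall al be : C,
    (forall u v, al * aeval (sysF S) u v + be * aeval (sysG S) u v = 0) ->
    al = 0 /\ be = 0.

Definition dFu (E : MAeq C) (v : 'I_4 -> C) (k : 'I_4) : C :=
  \sum_j (ma_a E k j - ma_a E j k) * v j + ma_b E k.
Definition dFv (E : MAeq C) (u : 'I_4 -> C) (k : 'I_4) : C :=
  \sum_j (ma_a E j k - ma_a E k j) * u j + ma_c E k.

Definition charM (S : MAsys C) (u v : 'I_4 -> C) (i : 'I_4) : 'M[C]_2 :=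
  \matrix_(r < 2, s < 2)
    if (r : nat) == 0%N then
      (if (s : nat) == 0%N then dFu (sysF S) v i else dFv (sysF S) u i)
    else
      (if (s : nat) == 0%N then dFu (sysG S) v i else dFv (sysG S) u i).

Definition chardet (S : MAsys C) (u v : 'I_4 -> C) (p : 'I_4 -> C) : C :=
  \det (\sum_i p i *: charM S u v i).

Definition basisv (i : 'I_4) : 'I_4 -> C := fun k => ((k == i) : nat)%:R.
Definition polar (q : ('I_4 -> C) -> C) : 'M[C]_4 :=
  \matrix_(i, j)
    ((q (fun k => basisv i k + basisv j k) - q (basisv i) - q (basisv j)) / 2%:R).

Definition quadric_rank (q : ('I_4 -> C) -> C) : nat := \rank (polar q).

Definition onX (S : MAsys C) (u v : 'I_4 -> C) : Prop :=
  aeval (sysF S) u v = 0 /\ aeval (sysG S) u v = 0.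

Inductive polyfun : (('I_4 -> C) -> ('I_4 -> C) -> C) -> Prop :=
| pf_const (c : C) : polyfun (fun _ _ => c)
| pf_u (i : 'I_4) : polyfun (fun u _ => u i)
| pf_v (i : 'I_4) : polyfun (fun _ v => v i)
| pf_add f g : polyfun f -> polyfun g -> polyfun (fun u v => f u v + g u v)
| pf_mul f g : polyfun f -> polyfun g -> polyfun (fun u v => f u v * g u v).

(* good points: the characteristic variety is a quadric of rank 4
   (for d = 4 this forces it to be an irreducible quadric) *)
Definition good_point (S : MAsys C) (u v : 'I_4 -> C) : Prop :=
  onX S u v /\ quadric_rank (chardet S u v) = 4%N.

(* non-degenerate: the characteristic variety is an irreducible quadric of
   rank 4 at a generic point of X, i.e. the good points form a nonempty
   Zariski-dense subset of (the affine part of) X. *)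
Definition MA_nondegenerate (S : MAsys C) : Prop :=
  (exists u v, good_point S u v) /\
  forall h, polyfun h ->
    (forall u v, good_point S u v -> h u v = 0) ->
    forall u v, onX S u v -> h u v = 0.

(* coordinates of V = C^6: columns 0..3 = x^1..x^4, column 4 = u, column 5 = v *)
Definition xcol (k : 'I_4) : 'I_6 := @widen_ord 4 6 isT k.
Definition ucol : 'I_6 := @Ordinal 6 4 isT.
Definition vcol : 'I_6 := @Ordinal 6 5 isT.
Definition colsel1 (i : 'I_4) (t : 'I_6) : 'I_4 -> 'I_6 :=
  fun k => if k == i then t else xcol k.
Definition colsel2 (i j : 'I_4) : 'I_4 -> 'I_6 :=
  fun k => if k == i then ucol else if k == j then vcol else xcol k.

(* A 4-plane W in V is given by a rank-4 matrix P : 'M_(4,6) whose rows span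
   W.  heval E P is the linear form on the Pluecker coordinates (4x4 minors
   of P) homogenising E: on the graph plane with rows e_i + u_i e_u + v_i e_v
   it equals aeval E u v, and it scales by det A under P |-> A *m P, so its
   vanishing only depends on W. *)
Definition heval (E : MAeq C) (P : 'M[C]_(4, 6)) : C :=
  \sum_i \sum_(j | i != j) ma_a E i j * \det (mxsub id (colsel2 i j) P)
  + \sum_i ma_b E i * \det (mxsub id (colsel1 i ucol) P)
  + \sum_i ma_c E i * \det (mxsub id (colsel1 i vcol) P)
  + ma_m E * \det (mxsub id xcol P).

(* W in X  (X = codimension-two linear section of Gr(4,V)) *)
Definition inX (S : MAsys C) (P : 'M[C]_(4, 6)) : Prop :=
  heval (sysF S) P = 0 /\ heval (sysG S) P = 0.

Definition SL_equiv (S1 S2 : MAsys C) : Prop :=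
  exists g : 'M[C]_6, \det g = 1 /\
    forall P : 'M[C]_(4, 6), \rank P = 4%N ->
      (inX S1 P <-> inX S2 (P *m g)).

Definition dlt (i : 'I_4) (n : nat) : C := ((i : nat) == n)%:R.
Definition z2 : 'I_4 -> 'I_4 -> C := fun _ _ => 0.
Definition z1 : 'I_4 -> C := fun _ => 0.

Definition eqA : MAeq C := MAEq z2 (fun i => dlt i 1) (fun i => - dlt i 0) 0.
Definition NF1 : MAsys C :=
  MASys eqA (MAEq z2 (fun i => dlt i 2) (fun i => dlt i 3) 0).
Definition NF2 : MAsys C :=
  MASys eqA (MAEq (fun i j => dlt i 0 * dlt j 1)
                  (fun i => dlt i 2) (fun i => dlt i 3) 0).
Definition NF3 : MAsys C :=
  MASys eqA (MAEq (fun i j => dlt i 2 * dlt j 3) z1 z1 (-1)).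
Definition NF4 : MAsys C :=
  MASys eqA (MAEq (fun i j => dlt i 2 * dlt j 3)
                  (fun i => dlt i 0) (fun i => dlt i 1) 0).

End MA.

(* Main.v *)
(** A Monge-Ampere equation is a bivector on V, i.e. a skew 6x6 matrix N: a
    4-plane satisfies it iff N is orthogonal to the matrix of its complementary
    minors. A system is thus a pencil of skew matrices x |-> x_0 N + x_1 M, and a
    congruence of the matrices combined with a linear substitution in x is an
    equivalence of systems.

    At a point of X where the characteristic quadric has rank 4, the bivectors of
    the system vanish on the 2-dimensional annihilator of the tangent plane, and
    its images under them span a complement. In adapted coordinates the pencil is
      [  A(x)    J(x) ]
      [ -J(x)^T  0    ]   with J(x) = [ x_0 I ; x_1 I ] and A(x) skew of size 4,
    and the remaining freedom adds J(x) S^T - S J(x)^T to A(x). Restricting A(x)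
    to the left kernel of J(x) kills these terms and loses nothing else, so the
    pencil is determined by the resulting binary cubic (its Pfaffian, up to
    sign). A substitution in x substitutes in the cubic, up to a factor that a
    rescaling absorbs. Over C a binary cubic is a product of linear forms, so
    only its root type matters: zero (NF1), a triple root (NF2), a double and a
    simple root (NF3) or three simple roots (NF4). *)

Require Import Defs.
From HB Require Import structures.
From mathcomp Require Import all_boot all_order all_algebra all_fingroup.
From mathcomp Require Import ring.
Import GRing.Theory Num.Theory.
Local Open Scope ring_scope.
Set Implicit Arguments. Unset Strict Implicit. Unset Printing Implicit Defensive.

(** * Matrix preliminaries *)

Lemma sum_ord2 (V : nmodType) (f : 'I_2 -> V) : \sum_i f i = f 0 + f 1.
Proof. by rewrite !big_ord_recl big_ord0 addr0; congr (_ + f _); apply: val_inj. Qed.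

Lemma det_mx22 (R : comPzRingType) (A : 'M[R]_2) :
  \det A = A 0 0 * A 1 1 - A 0 1 * A 1 0.
Proof.
rewrite (expand_det_row _ 0) sum_ord2 /cofactor !det_mx11 !mxE /=.
rewrite expr0 expr1 mul1r mulN1r mulrN.
by congr (_ * A _ _ - A _ _ * A _ _); apply: val_inj.
Qed.

Lemma skew_mx22_inj (F : fieldType) (A B : 'M[F]_2) : 2%:R != 0 :> F ->
  A^T = - A -> B^T = - B -> A 0 1 = B 0 1 -> A = B.
Proof.
move=> two_neq0 skewA skewB AB01; apply/matrixP => i j.
have entry_tr X (skewX : X^T = - X) k l : X l k = - X k l :> F.
  by move/matrixP: skewX => /(_ k l); rewrite !mxE.
have diag0 X (skewX : X^T = - X) k : X k k = 0 :> F.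
  apply: (mulfI two_neq0); rewrite mulr0 mulrDl !mul1r.
  by rewrite {1}entry_tr // addNr.
have ord2E (k : 'I_2) : k = 0 \/ k = 1.
  by case: k => -[|[|//]] lt_k; [left|right]; apply: val_inj.
have [[->|->] [->|->]] := (ord2E i, ord2E j); rewrite ?diag0 //.
by rewrite entry_tr // AB01 -entry_tr.
Qed.

Lemma congr_sub_tr (R : comPzRingType) n (g N : 'M[R]_n) :
  g *m (N - N^T) *m g^T = g *m N *m g^T - (g *m N *m g^T)^T.
Proof. by rewrite !trmx_mul trmxK mulmxBr mulmxBl !mulmxA. Qed.

(** * Complementary minors *)

Section ComplementaryMinors.

Variables (R : comPzRingType) (n : nat).
Implicit Types (P : 'M[R]_(n, n + (1 + 1))) (r s : 'rV[R]_(n + (1 + 1))).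
Implicit Types (g N : 'M[R]_(n + (1 + 1))).

Definition augdet P r s : R := \det (col_mx P (col_mx r s)).

Fact augdet_is_scalar P r : scalar (augdet P r).
Proof.
move=> a s t; rewrite -[augdet P r t]mul1r /augdet.
apply: (@determinant_multilinear _ _ _ _ _ (rshift n (rshift 1 0))).
- by rewrite !rowKd !row_id scale1r.
- by rewrite !row'Kd ![row' 0 _]flatmx0.
- by rewrite !row'Kd ![row' 0 _]flatmx0.
Qed.

HB.instance Definition _ P r :=
  GRing.isLinear.Build R _ R _ (augdet P r) (augdet_is_scalar P r).

Lemma augdetC P r s : augdet P r s = - augdet P s r.
Proof.
rewrite /augdet.
have -> : col_mx P (col_mx r s) =
    xrow (rshift n (lshift 1 0)) (rshift n (rshift 1 0)) (col_mx P (col_mx s r)).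
  apply/row_matrixP => i; rewrite xrowEsub row_rowsub.
  case: (split_ordP i) => k ->; last case: (split_ordP k) => l ->.
  - by rewrite tpermD ?eq_rlshift // !rowKu.
  - by rewrite ord1 tpermL !rowKd !rowKu.
  - by rewrite ord1 tpermR !rowKd !rowKu.
by rewrite xrowE det_mulmx det_perm odd_tperm eq_rshift eq_lrshift mulN1r.
Qed.

Definition cominors P : 'M[R]_(n + (1 + 1)) :=
  \matrix_(k, l) augdet P (delta_mx 0 k) (delta_mx 0 l).

Lemma augdetE P r s : augdet P r s = (r *m cominors P *m s^T) 0 0.
Proof.
rewrite {1}[s]row_sum_delta linear_sum mxE; apply: eq_bigr => j _.
rewrite linearZ /= mulrC !mxE; congr (_ * _).
rewrite augdetC {1}[r]row_sum_delta linear_sum -sumrN; apply: eq_bigr => i _.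
by rewrite linearZ /= -mulrN -augdetC mxE.
Qed.

Lemma tr_cominors P : (cominors P)^T = - cominors P.
Proof. by apply/matrixP => i j; rewrite !mxE augdetC. Qed.

Lemma cominors_diag P k : cominors P k k = 0.
Proof.
rewrite mxE.
apply: (@determinant_alternate _ _ _ (rshift n (lshift 1 0)) (rshift n (rshift 1 0))).
  by rewrite eq_rshift eq_lrshift.
by move=> j; rewrite !col_mxEd col_mxEu.
Qed.

Lemma cominors_mulmx P g : g *m cominors (P *m g) *m g^T = \det g *: cominors P.
Proof.
apply/matrixP => i j; rewrite !mxE.
transitivity (augdet (P *m g) (row i g) (row j g)).
  by rewrite augdetE -row_mul tr_row !mxE; apply: eq_bigr => k _; rewrite !mxE.
by rewrite /augdet !rowE -!mul_col_mx det_mulmx mulrC.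
Qed.

Lemma cominors_colsub P (s : {perm 'I_(n + (1 + 1))}) k l :
  cominors (colsub s P) k l = (-1) ^+ s * cominors P (s k) (s l).
Proof.
have colsub_delta i : delta_mx 0 i = colsub s (delta_mx 0 (s i)) :> 'rV[R]__.
  by apply/rowP => j; rewrite !mxE (inj_eq perm_inj).
have colsub_col_mx p q (A : 'M[R]_(p, _)) (B : 'M[R]_(q, _)) :
    col_mx (colsub s A) (colsub s B) = colsub s (col_mx A B).
  by apply/matrixP => i j; rewrite !mxE; case: splitP => ? _; rewrite mxE.
rewrite !mxE /augdet (colsub_delta k) (colsub_delta l) !colsub_col_mx.
by rewrite -col_permEsub col_permE det_mulmx det_perm odd_permV mulrC.
Qed.

Lemma det_lsubmx P :
  \det (lsubmx P) = cominors P (rshift n (lshift 1 0)) (rshift n (rshift 1 0)).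
Proof.
set k := rshift n (lshift 1 0); set l := rshift n (rshift 1 0).
have unit_rows :
    col_mx (delta_mx 0 k) (delta_mx 0 l) = row_mx 0 1%:M :> 'M[R]_(1 + 1, _).
  apply/row_matrixP => i; rewrite row_row_mx row0 row1.
  by case: (split_ordP i) => i' ->; rewrite (rowKu, rowKd) row_id ord1;
    apply/rowP => j; rewrite !mxE; case: split_ordP => j' ->; rewrite mxE !eq_shift.
by rewrite mxE /augdet unit_rows -{2}[P]hsubmxK -block_mxEv det_ublock det1 mulr1.
Qed.

Definition pairing P N : R := \tr (N^T *m cominors P).

Fact pairing_is_scalar P : scalar (pairing P).
Proof. by move=> a N M; rewrite /pairing linearP mulmxDl -scalemxAl linearP. Qed.

HB.instance Definition _ P :=
  GRing.isLinear.Build R _ R _ (pairing P) (pairing_is_scalar P).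

Lemma pairingE P N : pairing P N = \sum_i \sum_j N i j * cominors P i j.
Proof.
rewrite /pairing /mxtrace exchange_big /=; apply: eq_bigr => j _; rewrite mxE.
by apply: eq_bigr => i _; rewrite mxE.
Qed.

Lemma pairing_tr P N : pairing P N^T = - pairing P N.
Proof.
rewrite /pairing trmxK -mxtrace_tr trmx_mul tr_cominors mulNmx linearN.
by rewrite mxtrace_mulC.
Qed.

Lemma pairing_congr g P N :
  pairing (P *m g^T) (g *m N *m g^T) = \det g * pairing P N.
Proof.
have := cominors_mulmx P g^T; rewrite trmxK det_tr => cominors_g.
rewrite /pairing !trmx_mul trmxK -!mulmxA mxtrace_mulC -!mulmxA.
by rewrite [g^T *m (_ *m g)]mulmxA cominors_g -scalemxAr linearZ.
Qed.

End ComplementaryMinors.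

(** * Pencils of matrices *)
Definition pencil (R : pzRingType) (V : lmodType R) (N M : V) (x : 'rV[R]_2) : V :=
  x 0 0 *: N + x 0 1 *: M.

Fact pencil_is_linear (R : pzRingType) (V : lmodType R) (N M : V) :
  linear (pencil N M).
Proof. by move=> a x y; rewrite /pencil !mxE !scalerDl scalerDr !scalerA addrACA. Qed.

HB.instance Definition _ (R : pzRingType) (V : lmodType R) (N M : V) :=
  GRing.isLinear.Build R _ _ _ (pencil N M) (pencil_is_linear N M).

Lemma linear_pencilE (R : comPzRingType) (V : lmodType R) (A : {linear 'rV[R]_2 -> V}) :
  A =1 pencil (A (delta_mx 0 0)) (A (delta_mx 0 1)).
Proof. by move=> x; rewrite {1}[x]row_sum_delta linear_sum sum_ord2 !linearZ. Qed.

Section Congruence.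

Variables (R : comUnitRingType) (m : nat).
Implicit Types P Q S : 'rV[R]_2 -> 'M[R]_m.

Definition congruent P Q : Prop :=
  exists g h, [/\ g \in unitmx, h \in unitmx & forall x, Q x = g *m P (x *m h) *m g^T].

Lemma congruent_sym P Q : congruent P Q -> congruent Q P.
Proof.
move=> [g [h [gu hu QE]]]; exists (invmx g), (invmx h); rewrite !unitmx_inv.
split=> // x; rewrite QE mulmxKV // !mulmxA mulVmx // mul1mx.
by rewrite trmx_inv mulmxK ?unitmx_tr.
Qed.

Lemma congruent_trans Q P S : congruent P Q -> congruent Q S -> congruent P S.
Proof.
move=> [g [h [gu hu QE]]] [g' [h' [gu' hu' SE]]]; exists (g' *m g), (h' *m h).
by rewrite !unitmx_mul; split=> [||x]; [apply/andP..|rewrite SE QE trmx_mul !mulmxA].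
Qed.

End Congruence.

Section BorderedMatrices.

Variables (R : comPzRingType) (m n : nat).
Implicit Types (A B : 'M[R]_m) (J K : 'M[R]_(m, n)).

Definition bordermx A J : 'M[R]_(m + n) := block_mx A J (- J^T) 0.

Lemma bordermx_congr L S d A J :
  block_mx L S 0 d *m bordermx A J *m (block_mx L S 0 d)^T =
  bordermx (L *m A *m L^T + (L *m J *m S^T - (L *m J *m S^T)^T)) (L *m J *m d^T).
Proof.
rewrite /bordermx tr_block_mx !mulmx_block trmx0.
rewrite !(mul0mx, mulmx0, addr0, add0r) !trmx_mul !trmxK.
by rewrite !mulmxDl !mulmxN !mulNmx -!mulmxA -[_ + _ + _]addrA [- _ + _]addrC.
Qed.

Lemma pencil_bordermx A B J K x :
  pencil (bordermx A J) (bordermx B K) x = bordermx (pencil A B x) (pencil J K x).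
Proof.
rewrite /pencil /bordermx !scale_block_mx add_block_mx !scaler0 addr0.
by congr block_mx; rewrite linearD !linearZ /= !scalerN opprD.
Qed.

End BorderedMatrices.

Lemma congruent_bordermx (R : comUnitRingType) m n L S d h
    (A B : 'rV[R]_2 -> 'M[R]_m) (J K : 'rV[R]_2 -> 'M[R]_(m, n)) :
    L \in unitmx -> d \in unitmx -> h \in unitmx ->
    (forall x, B x = L *m A (x *m h) *m L^T
                     + (L *m J (x *m h) *m S^T - (L *m J (x *m h) *m S^T)^T)) ->
    (forall x, K x = L *m J (x *m h) *m d^T) ->
  congruent (fun x => bordermx (A x) (J x)) (fun x => bordermx (B x) (K x)).
Proof.
move=> Lu du hu BE KE; exists (block_mx L S 0 d), h.
by split=> // [|x]; [rewrite unitmxE det_ublock unitrM -!unitmxE Lu|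
  rewrite bordermx_congr -BE -KE].
Qed.

(** * The cubic of a canonical pencil *)

Section CanonicalPencils.

Variables (R : comUnitRingType) (n : nat).
Implicit Types (A : 'rV[R]_2 -> 'M[R]_(n + n)) (x : 'rV[R]_2) (h : 'M[R]_2).

Definition stackmx x : 'M[R]_(n + n, n) := col_mx (x 0 0)%:M (x 0 1)%:M.

(* Over a field, its rows span the left kernel of [stackmx x] for [x != 0]. *)
Definition perpmx x : 'M[R]_(n, n + n) := row_mx (x 0 1)%:M (- x 0 0)%:M.

Definition canonical_pencil A x : 'M[R]_(n + n + n) := bordermx (A x) (stackmx x).

Definition cubicmx A x : 'M[R]_n := perpmx x *m A x *m (perpmx x)^T.

Definition skew_pencil A : Prop := forall x, (A x)^T = - A x.

Lemma stackmxZ a x : stackmx (a *: x) = a *: stackmx x.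
Proof. by rewrite /stackmx !mxE scale_col_mx !scale_scalar_mx. Qed.

Lemma tr_cubicmx A x : skew_pencil A -> (cubicmx A x)^T = - cubicmx A x.
Proof. by move=> skewA; rewrite !trmx_mul trmxK skewA mulNmx mulmxN mulmxA. Qed.

Lemma cubicmxE A x : cubicmx A x =
  x 0 1 ^+ 2 *: ulsubmx (A x) - (x 0 0 * x 0 1) *: (ursubmx (A x) + dlsubmx (A x))
    + x 0 0 ^+ 2 *: drsubmx (A x).
Proof.
rewrite /cubicmx -{1}[A x]submxK /perpmx mul_row_block tr_row_mx mul_row_col.
rewrite !tr_scalar_mx !mul_mx_scalar !mul_scalar_mx !scalerDr !scalerA !addrA.
rewrite !mulrNN !mulNr !mulrN !scaleNr opprD addrA -!expr2.
by rewrite [x 0 1 * x 0 0]mulrC [_ - _ - _ *: ursubmx _]addrAC.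
Qed.

(* The Kronecker product of [h] with the identity matrix. *)
Definition scalar_block h : 'M[R]_(n + n) :=
  block_mx (h 0 0)%:M (h 0 1)%:M (h 1 0)%:M (h 1 1)%:M.

Lemma scalar_blockM h h' : scalar_block (h *m h') = scalar_block h *m scalar_block h'.
Proof. by rewrite mulmx_block -!scalar_mxM -!raddfD /scalar_block !mxE !sum_ord2. Qed.

Lemma scalar_block1 : scalar_block 1%:M = 1%:M.
Proof. by rewrite /scalar_block !mxE /= !mulr0n raddf0 -scalar_mx_block. Qed.

Lemma scalar_block_unit h : h \in unitmx -> scalar_block h \in unitmx.
Proof.
move=> /mulmxV/(congr1 scalar_block).
by rewrite scalar_blockM scalar_block1 => /mulmx1_unit[].
Qed.

Lemma mul_scalar_block_stackmx h x : scalar_block h^T *m stackmx x = stackmx (x *m h).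
Proof.
rewrite mul_block_col -!scalar_mxM -!raddfD /stackmx !mxE !sum_ord2.
by rewrite ![x 0 _ * _]mulrC.
Qed.

Lemma mul_perpmx_scalar_block h x :
  perpmx (x *m h) *m scalar_block h^T = \det h *: perpmx x.
Proof.
rewrite mul_row_block -!scalar_mxM -!raddfD /perpmx scale_row_mx !scale_scalar_mx.
by rewrite !mxE !sum_ord2 det_mx22; congr row_mx; congr scalar_mx; ring.
Qed.

Definition substmx h : 'M[R]_(n + n) := scalar_block (invmx h)^T.

Definition subst_pencil h A : 'rV[R]_2 -> 'M[R]_(n + n) :=
  mulmxr (substmx h)^T \o mulmx (substmx h) \o A \o mulmxr h.

HB.instance Definition _ h (A : {linear 'rV[R]_2 -> 'M[R]_(n + n)}) :=
  GRing.Linear.copy (subst_pencil h A)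
    (mulmxr (substmx h)^T \o mulmx (substmx h) \o A \o mulmxr h).

Lemma substmx_unit h : h \in unitmx -> substmx h \in unitmx.
Proof. by move=> hu; rewrite scalar_block_unit // unitmx_tr unitmx_inv. Qed.

Lemma mul_substmx_stackmx h x : h \in unitmx -> substmx h *m stackmx (x *m h) = stackmx x.
Proof. by move=> hu; rewrite mul_scalar_block_stackmx mulmxK. Qed.

Lemma skew_subst_pencil h A : skew_pencil A -> skew_pencil (subst_pencil h A).
Proof. by move=> skewA x; rewrite !trmx_mul trmxK skewA mulNmx mulmxN mulmxA. Qed.

Lemma cubicmx_subst h A x : h \in unitmx ->
  cubicmx (subst_pencil h A) x = (\det h) ^- 2 *: cubicmx A (x *m h).
Proof.
move=> hu; have perp_subst : perpmx x *m substmx h = (\det h)^-1 *: perpmx (x *m h).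
  by rewrite -{1}[x](mulmxK hu) mul_perpmx_scalar_block det_inv.
have -> : cubicmx (subst_pencil h A) x =
    (perpmx x *m substmx h) *m A (x *m h) *m (perpmx x *m substmx h)^T.
  by rewrite /cubicmx /= trmx_mul !mulmxA.
rewrite perp_subst [(_ *: _)^T]linearZ /= -!scalemxAl -scalemxAr scalerA.
by rewrite -expr2 exprVn.
Qed.

End CanonicalPencils.

Section CubicClassifiesPencils.

Variables (F : fieldType) (n : nat).
Hypothesis two_neq0 : 2%:R != 0 :> F.

Lemma binary_cubic_eq0 (V : lmodType F) (a b c d : V) :
    (forall x : 'rV[F]_2, x 0 0 ^+ 3 *: a + (x 0 0 ^+ 2 * x 0 1) *: b
       + (x 0 0 * x 0 1 ^+ 2) *: c + x 0 1 ^+ 3 *: d = 0) ->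
  [/\ a = 0, b = 0, c = 0 & d = 0].
Proof.
move=> form0; pose point s t : 'rV[F]_2 := \row_j if j == 0 then s else t.
have form_at s t :
    s ^+ 3 *: a + (s ^+ 2 * t) *: b + (s * t ^+ 2) *: c + t ^+ 3 *: d = 0.
  by have := form0 (point s t); rewrite !mxE.
have a0 : a = 0.
  by have := form_at 1 0; rewrite !expr1n !expr0n /= !mulr0 !scale0r scale1r !addr0.
have d0 : d = 0.
  by have := form_at 0 1; rewrite !expr1n !expr0n /= !mul0r !scale0r scale1r !add0r.
have b_plus_c : b + c = 0.
  by have := form_at 1 1; rewrite a0 d0 !scaler0 add0r addr0 !expr1n mul1r !scale1r.
have b_eq_c : b = c.
  have := form_at 1 (-1); rewrite a0 d0 !scaler0 add0r addr0 !expr1n !mul1r sqrrN expr1n.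
  by rewrite scaleN1r scale1r addrC => /subr0_eq.
have c0 : c = 0.
  apply/eqP; move/eqP: b_plus_c.
  by rewrite b_eq_c -mulr2n -scaler_nat scaler_eq0 (negPf two_neq0).
by split; rewrite // b_eq_c.
Qed.

Lemma cubicmx_eq0 (D : {linear 'rV[F]_2 -> 'M[F]_(n + n)}) :
    skew_pencil D -> (forall x, cubicmx D x = 0) ->
  exists S, forall x, D x = stackmx n x *m S^T - (stackmx n x *m S^T)^T.
Proof.
move=> skewD cubic0; pose N := D (delta_mx 0 0); pose M := D (delta_mx 0 1).
have skewN : N^T = - N by rewrite skewD.
have skewM : M^T = - M by rewrite skewD.
have [Ndr Mdr Nul Mul] : [/\ drsubmx N = 0,
    drsubmx M - (ursubmx N + dlsubmx N) = 0,
    ulsubmx N - (ursubmx M + dlsubmx M) = 0 & ulsubmx M = 0].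
  apply: binary_cubic_eq0 => x.
  rewrite -[RHS](cubic0 x) cubicmxE linear_pencilE !linearD !linearZ /=.
  by apply/matrixP => i j; rewrite !mxE; ring.
exists (col_mx (- ursubmx M) (ursubmx N)^T) => x.
rewrite tr_col_mx mul_col_row tr_block_mx opp_block_mx add_block_mx linear_pencilE.
rewrite /pencil -/N -/M -{1}[N]submxK -{1}[M]submxK !scale_block_mx add_block_mx.
rewrite Ndr Mul (subr0_eq Nul) (subr0_eq Mdr) !mul_scalar_mx !linearZ !linearN /= !trmxK.
rewrite !trmx_ursub skewN skewM.
by congr block_mx; apply/matrixP => i j; rewrite !mxE; ring.
Qed.

Lemma canonical_pencil_congruent (A B : {linear 'rV[F]_2 -> 'M[F]_(n + n)}) k h :
    skew_pencil A -> skew_pencil B -> k != 0 -> h \in unitmx ->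
    (forall x, cubicmx B x = k *: cubicmx A (x *m h)) ->
  congruent (canonical_pencil A) (canonical_pencil B).
Proof.
move=> skewA skewB k0 hu cubicB; have deth : \det h != 0 by rewrite -unitfE -unitmxE.
pose c := k * \det h ^+ 2; have c0 : c != 0 by rewrite mulf_neq0 ?expf_neq0.
pose D := B \- (c \*: subst_pencil h A).
have [|x|S DS] := @cubicmx_eq0 D.
- move=> x; rewrite linearB linearZ /= skewB skew_subst_pencil //.
  by rewrite scalerN opprB opprK addrC.
- rewrite {1}/cubicmx mulmxBr mulmxBl -scalemxAr -scalemxAl -/(cubicmx B x) cubicB.
  rewrite -/(cubicmx (subst_pencil h A) x).
  by rewrite cubicmx_subst // scalerA mulfK ?expf_neq0 // subrr.
have stack_scaled x : substmx n h *m stackmx n (x *m (c *: h)) = c *: stackmx n x.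
  by rewrite -scalemxAr stackmxZ -scalemxAr mul_substmx_stackmx.
apply: (@congruent_bordermx _ _ _ (substmx n h) (c^-1 *: S) c^-1%:M (c *: h)) => [|||x|x].
- exact: substmx_unit.
- by rewrite unitmxE det_scalar unitfE expf_neq0 ?invr_neq0.
- by rewrite unitmxZ ?unitfE.
- have -> : substmx n h *m stackmx n (x *m (c *: h)) *m (c^-1 *: S)^T = stackmx n x *m S^T.
    by rewrite stack_scaled linearZ /= -scalemxAr -scalemxAl scalerA mulVf // scale1r.
  by rewrite -DS -scalemxAr linearZ -scalemxAr -scalemxAl addrC subrK.
- by rewrite stack_scaled tr_scalar_mx mul_mx_scalar scalerA mulVf // scale1r.
Qed.

End CubicClassifiesPencils.

(** * Binary cubic forms *)

Section LinearForms.

Variable F : fieldType.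
Implicit Types (u v w x : 'rV[F]_2) (f g : 'rV[F]_2 -> F).

Definition linform v x : F := (x *m v^T) 0 0.

Definition linform_prod u v w x : F := linform u x * linform v x * linform w x.

Definition cubic_equiv f g : Prop :=
  exists k h, [/\ k != 0, h \in unitmx & forall x, f x = k * g (x *m h)].

Definition triple_root_cubic x : F := x 0 1 ^+ 3.
Definition double_root_cubic x : F := x 0 0 ^+ 2 * x 0 1.
Definition simple_roots_cubic x : F := x 0 1 * (x 0 0 ^+ 2 + x 0 1 ^+ 2).

Lemma linformE v x : linform v x = x 0 0 * v 0 0 + x 0 1 * v 0 1.
Proof. by rewrite /linform !mxE sum_ord2 !mxE. Qed.

Lemma linformD u v x : linform (u + v) x = linform u x + linform v x.
Proof. by rewrite !linformE !mxE; ring. Qed.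

Lemma linformZ a v x : linform (a *: v) x = a * linform v x.
Proof. by rewrite !linformE !mxE; ring. Qed.

Lemma row0_col_mx u v : row 0 (col_mx u v) = u.
Proof. by rewrite -[RHS](row_id 0 _) -(rowKu 0 u v); congr row; apply: val_inj. Qed.

Lemma row1_col_mx u v : row 1 (col_mx u v) = v.
Proof. by rewrite -[RHS](row_id 0 _) -(rowKd 0 u v); congr row; apply: val_inj. Qed.

Lemma det_col_mx2 u v : \det (col_mx u v) = u 0 0 * v 0 1 - u 0 1 * v 0 0.
Proof.
have entry i j : col_mx u v i j = (row i (col_mx u v)) 0 j by rewrite [RHS]mxE.
by rewrite det_mx22 !entry row0_col_mx row1_col_mx.
Qed.

Lemma row_collinear_or_free n (u v : 'rV[F]_n) :
  u != 0 -> (exists a, v = a *: u) \/ row_free (col_mx u v).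
Proof.
move=> u0; have [/sub_rVP ?|v_notin_u] := boolP (v <= u)%MS; [by left|right].
have /rank_ltmx : (u < u + v)%MS.
  by rewrite /ltmx addsmxSl; apply: contra v_notin_u; apply/submx_trans/addsmxSr.
by rewrite rank_rV u0 addsmxE row_leq_rank.
Qed.

Lemma row_completion n (u : 'rV[F]_(n + 1)) :
  u != 0 -> exists v : 'M_(n, n + 1), col_mx v u \in unitmx.
Proof.
move=> u0.
have [|g gu] := @complete_unitmx _ _ _ (row_mx (0 : 'rV_n) 1%:M) (col_mx 0 u).
  by rewrite mul_row_col mul0mx mul1mx add0r !rank_rV u0 row_mx_eq0 oner_eq0 andbF.
rewrite -{1}[g]vsubmxK !mul_row_col !mul0mx !mul1mx !add0r => ->.
by exists (usubmx g); rewrite vsubmxK.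
Qed.

Lemma cubic_equiv_linforms k u v f (g : F -> F -> F) :
    k != 0 -> col_mx u v \in unitmx ->
    (forall x, f x = k * g (linform u x) (linform v x)) ->
  cubic_equiv f (fun x => g (x 0 0) (x 0 1)).
Proof.
move=> k0 uv fE; exists k, (col_mx u v)^T; rewrite unitmx_tr; split=> // x.
have xh i : (x *m (col_mx u v)^T) 0 i = linform (row i (col_mx u v)) x.
  by rewrite linformE mxE sum_ord2 !mxE.
by rewrite fE !xh row0_col_mx row1_col_mx.
Qed.

Lemma linform_prod_zero u v w :
  [|| u == 0, v == 0 | w == 0] -> cubic_equiv (linform_prod u v w) (fun=> 0).
Proof.
have linform0 x : linform 0 x = 0 by rewrite linformE !mxE !mulr0 addr0.
move=> zero; exists 1, 1%:M; rewrite oner_neq0 unitmx1; split=> // x.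
rewrite /linform_prod mul1r.
by case/or3P: zero => /eqP ->; rewrite linform0 ?(mul0r, mulr0).
Qed.

Lemma linform_prod_collinear a u v : a != 0 -> u != 0 -> v != 0 ->
  cubic_equiv (linform_prod u (a *: u) v) triple_root_cubic \/
  cubic_equiv (linform_prod u (a *: u) v) double_root_cubic.
Proof.
move=> a0 u0 v0; have [[b vb]|uv] := row_collinear_or_free v u0; [left|right].
  have b0 : b != 0 by apply: contraNneq v0 => b0; rewrite vb b0 scale0r.
  have [w wu] := @row_completion 1 u u0.
  apply: (@cubic_equiv_linforms (a * b) w u _ (fun _ t => t ^+ 3)) => // [|x].
    by rewrite mulf_neq0.
  by rewrite /linform_prod vb !linformZ; ring.
apply: (@cubic_equiv_linforms a u v _ (fun s t => s ^+ 2 * t)) => // [|x].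
  by rewrite -row_free_unit.
by rewrite /linform_prod linformZ; ring.
Qed.

End LinearForms.

Section SplitCubics.

Variable F : closedFieldType.
Implicit Types u v w : 'rV[F]_2.

Lemma binary_form_split n (p : {poly F}) : (size p <= n.+1)%N ->
  exists c (s : n.-tuple 'rV[F]_2), forall x : 'rV[F]_2,
    \sum_(i < n.+1) p`_i * (x 0 0 ^+ i * x 0 1 ^+ (n - i))
      = c * \prod_(v <- s) linform v x.
Proof.
elim: n => [|n IHn] in p *.
  by exists p`_0, [tuple] => x; rewrite big_ord1 big_nil !mulr1.
rewrite leq_eqVlt => /orP[/eqP size_p|size_p]; last first.
  have [c [s IHp]] := IHn p size_p; exists c, [tuple of delta_mx 0 1 :: s] => x.
  rewrite big_ord_recr /= nth_default // mul0r addr0 big_cons mulrCA -IHp mulr_sumr.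
  by apply: eq_bigr => i _; rewrite subSn ?leq_ord // exprS linformE !mxE /=; ring.
have /closed_rootP[z /factor_theorem[q pq]] : size p != 1 by rewrite size_p.
have size_q : (size q <= n.+1)%N.
  have q0 : q != 0 by apply/eqP => q0; move: size_p; rewrite pq q0 mul0r size_poly0.
  by move: size_p; rewrite pq size_Mmonic ?monicXsubC // size_XsubC addn2 => -[->].
have pE i : p`_i = (if i == 0%N then 0 else q`_i.-1) - q`_i * z.
  by rewrite pq mulrBr coefB coefMX coefMC.
have [c [s IHq]] := IHn q size_q.
exists c, [tuple of (\row_j if j == 0 then 1 else - z) :: s] => x.
rewrite big_cons mulrCA -IHq linformE !mxE /= mulr1 mulrDl !mulr_sumr.
under eq_bigr do rewrite pE mulrBl.
rewrite sumrB big_ord_recl /= mul0r add0r; congr (_ + _).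
  by apply: eq_bigr => i _; rewrite exprS subSS -mulrA mulrCA.
rewrite big_ord_recr /= nth_default // !mul0r addr0 -sumrN; apply: eq_bigr => i _.
by rewrite subSn ?leq_ord // exprS; ring.
Qed.

Lemma cubicmx_split n (A : {linear 'rV[F]_2 -> 'M[F]_(n + n)}) i j :
  exists u v w, forall x, cubicmx A x i j = linform_prod u v w x.
Proof.
pose N := A (delta_mx 0 0); pose M := A (delta_mx 0 1).
pose p := Poly [:: ulsubmx M i j; ulsubmx N i j - (ursubmx M i j + dlsubmx M i j);
  drsubmx M i j - (ursubmx N i j + dlsubmx N i j); drsubmx N i j].
have cubicE x :
    cubicmx A x i j = \sum_(k < 4) p`_k * (x 0 0 ^+ k * x 0 1 ^+ (3 - k)).
  rewrite cubicmxE linear_pencilE /pencil !big_ord_recl big_ord0 !coef_Poly /= !mxE.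
  by rewrite /bump /=; ring.
have [|c [[[|u [|v [|w [|? ?]]]] //= _] pE]] := @binary_form_split 3 p.
  exact: size_Poly.
exists (c *: u), v, w => x; rewrite cubicE pE !big_cons big_nil /linform_prod linformZ.
by ring.
Qed.

Hypothesis two_neq0 : 2%:R != 0 :> F.

Lemma linform_prod_simple a b u v : a != 0 -> b != 0 -> col_mx u v \in unitmx ->
  cubic_equiv (linform_prod u v (a *: u + b *: v)) (@simple_roots_cubic F).
Proof.
move=> a0 b0 uv; have [i i2] := imaginary_exists F.
have i0 : i != 0.
  by apply: contra_eq_neq i2 => ->; rewrite expr0n eq_sym oppr_eq0 oner_neq0.
have four_neq0 : 4%:R != 0 :> F by rewrite (natrM _ 2 2) mulf_neq0.
pose u' := i *: (a *: u + - b *: v); pose v' := a *: u + b *: v.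
(* [4 a b s t = (i (a s - b t))^2 + (a s + b t)^2] *)
apply: (@cubic_equiv_linforms F (4%:R * a * b)^-1 u' v' _
  (fun s t => t * (s ^+ 2 + t ^+ 2))) => [||x].
- by rewrite invr_neq0 // !mulf_neq0.
- have det_uv' : \det (col_mx u' v') = 2%:R * i * a * b * \det (col_mx u v).
    by rewrite !det_col_mx2 !mxE; ring.
  by rewrite unitmxE det_uv' unitfE !mulf_neq0 // -unitfE -unitmxE.
rewrite /linform_prod linformZ !linformD !linformZ exprMn i2.
by field; rewrite a0 b0.
Qed.

Lemma linform_prod_classification u v w (f := linform_prod u v w) :
  [\/ cubic_equiv f (fun=> 0), cubic_equiv f (@triple_root_cubic F),
      cubic_equiv f (@double_root_cubic F) | cubic_equiv f (@simple_roots_cubic F)].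
Proof.
have [|] := boolP [|| u == 0, v == 0 | w == 0].
  by move/linform_prod_zero; apply: Or41.
rewrite !negb_or => /and3P[u0 v0 w0].
have [[a va]|] := row_collinear_or_free v u0.
  have a0 : a != 0 by apply: contraNneq v0 => a0; rewrite va a0 scale0r.
  rewrite /f va.
  by case: (linform_prod_collinear a0 u0 w0); [apply: Or42|apply: Or43].
rewrite row_free_unit => uv; have [a [b wE]] : exists a b, w = a *: u + b *: v.
  pose c : 'rV_(1 + 1) := w *m invmx (col_mx u v).
  exists (lsubmx c 0 0), (rsubmx c 0 0).
  by rewrite -!mul_scalar_mx -!mx11_scalar -mul_row_col hsubmxK mulmxKV.
have fE x : f x = linform u x * linform v x * (a * linform u x + b * linform v x).
  by rewrite /f /linform_prod wE linformD !linformZ.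
have [b0|b0] := eqVneq b 0.
  have a0 : a != 0 by apply: contraNneq w0 => a0; rewrite wE a0 b0 !scale0r addr0.
  apply/Or43/(@cubic_equiv_linforms F a u v _ (fun s t => s ^+ 2 * t)) => // x.
  by rewrite fE b0; ring.
have [a0|a0] := eqVneq a 0; last by rewrite /f wE; apply/Or44/linform_prod_simple.
apply/Or43/(@cubic_equiv_linforms F b v u _ (fun s t => s ^+ 2 * t)) => // [|x].
  have det_vu : \det (col_mx v u) = - \det (col_mx u v) by rewrite !det_col_mx2; ring.
  by rewrite unitmxE det_vu unitfE oppr_eq0 -unitfE -unitmxE.
by rewrite fE a0; ring.
Qed.

End SplitCubics.

(** * Equations as bivectors *)

Section Bivectors.

Variable F : fieldType.
Implicit Types (E : MAeq F) (P : 'M[F]_(4, 6)).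

(* Columns are grouped as x^1..x^4 followed by u, v. The coefficient of u_i sits at
   (x^i, v), the two columns missing from the minor in which u replaces x^i, and
   that of v_i at (x^i, u). *)
Definition quadcoef E : 'M[F]_(2 + 2) := \matrix_(i, j) ma_a E i j.
Definition lincoef E : 'M[F]_(2 + 2, 2) :=
  \matrix_(i, s) if s == 0 then ma_c E i else - ma_b E i.
Definition coefmx E : 'M[F]_(2 + 2 + 2) :=
  block_mx (quadcoef E) (lincoef E) 0 (ma_m E *: delta_mx 0 1).

Definition bivector E : 'M[F]_(2 + 2 + 2) := coefmx E - (coefmx E)^T.

Lemma lshift_xcol (k : 'I_4) : lshift 2 k = Defs.xcol k.
Proof. exact: val_inj. Qed.

Lemma rshift_ucol : rshift 4 (0 : 'I_2) = ucol.
Proof. exact: val_inj. Qed.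

Lemma rshift_vcol : rshift 4 (1 : 'I_2) = vcol.
Proof. exact: val_inj. Qed.

Lemma xcol_eqE k :
  ((forall l, (Defs.xcol k == Defs.xcol l) = (k == l))
   * ((Defs.xcol k == ucol) = false) * ((Defs.xcol k == vcol) = false)
   * ((ucol == Defs.xcol k) = false) * ((vcol == Defs.xcol k) = false))%type.
Proof. by case: k => -[|[|[|[|k]]]]. Qed.

Lemma sum_cols (V : nmodType) (f : 'I_6 -> V) :
  \sum_k f k = \sum_i f (Defs.xcol i) + (f ucol + f vcol).
Proof.
rewrite (@big_split_ord _ _ _ 4 2) sum_ord2 rshift_ucol rshift_vcol.
by congr (_ + _); apply: eq_bigr => k _; rewrite lshift_xcol.
Qed.

Lemma coefmxE E :
  ((forall i j, coefmx E (Defs.xcol i) (Defs.xcol j) = ma_a E i j)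
   * (forall i, coefmx E (Defs.xcol i) ucol = ma_c E i)
   * (forall i, coefmx E (Defs.xcol i) vcol = - ma_b E i)
   * (forall i, coefmx E ucol (Defs.xcol i) = 0)
   * (forall i, coefmx E vcol (Defs.xcol i) = 0)
   * (coefmx E ucol vcol = ma_m E) * (coefmx E vcol ucol = 0))%type.
Proof.
by do ![split] => *; rewrite -?lshift_xcol -?rshift_ucol -?rshift_vcol
  ?block_mxEul ?block_mxEur ?block_mxEdl ?block_mxEdr !mxE //= ?mulr1 ?mulr0.
Qed.

Lemma det_colsub P (s : {perm 'I_6}) f : (forall k, f k = s (Defs.xcol k)) ->
  \det (colsub f P) = (-1) ^+ s * @cominors F 4 P (s ucol) (s vcol).
Proof.
have [-> ->] : ucol = rshift 4 (lshift 1 (0 : 'I_1)) /\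
    vcol = rshift 4 (rshift 1 (0 : 'I_1)) by split; apply: val_inj.
move=> fE; rewrite -(@cominors_colsub F 4) -(@det_lsubmx F 4); congr (\det _).
by apply/matrixP => i k; rewrite !mxE fE; congr (P _ (s _)); apply: val_inj.
Qed.

Lemma det_xcol P : \det (mxsub id Defs.xcol P) = @cominors F 4 P ucol vcol.
Proof. by rewrite (@det_colsub _ 1%g) ?odd_perm1 ?mul1r => [|k]; rewrite ?perm1. Qed.

Lemma det_colsel1 P i t : (forall k, (Defs.xcol k == t) = false) ->
  \det (mxsub id (colsel1 i t) P) =
  - @cominors F 4 P (tperm (Defs.xcol i) t ucol) (tperm (Defs.xcol i) t vcol).
Proof.
move=> xt; rewrite (@det_colsub _ (tperm (Defs.xcol i) t)) => [|k].
  by rewrite odd_tperm xt expr1 mulN1r.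
by rewrite permE /= xcol_eqE xt.
Qed.

Lemma det_colsel2 P i j : i != j ->
  \det (mxsub id (colsel2 i j) P) = @cominors F 4 P (Defs.xcol i) (Defs.xcol j).
Proof.
move=> /negPf ij.
rewrite (@det_colsub _ (tperm (Defs.xcol i) ucol * tperm (Defs.xcol j) vcol)) => [|k].
  by rewrite odd_permM !odd_tperm !xcol_eqE mul1r !permM tpermR !permE /= !xcol_eqE ij.
rewrite /colsel2 permM !permE /= !xcol_eqE.
by have [_|] := eqVneq k i; rewrite !xcol_eqE.
Qed.

Lemma hevalE E P : heval E P = @pairing F 4 P (coefmx E).
Proof.
have cominorsC k l : @cominors F 4 P k l = - @cominors F 4 P l k.
  by have /matrixP/(_ l k) := @tr_cominors F 4 P; rewrite !mxE.
have coef_row0 t : (forall i, coefmx E t (Defs.xcol i) = 0) ->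
    \sum_i coefmx E t (Defs.xcol i) * @cominors F 4 P t (Defs.xcol i) = 0.
  by move=> t0; rewrite big1 // => i _; rewrite t0 mul0r.
rewrite pairingE sum_cols !sum_cols !coef_row0 => [|i|i]; rewrite ?coefmxE //.
rewrite !cominors_diag !mulr0 !mul0r !addr0 !add0r /heval det_xcol -!big_split /=.
congr (_ + _); apply: eq_bigr => i _; rewrite sum_cols !coefmxE -addrA; congr (_ + _).
  rewrite [RHS](bigD1 i) //= cominors_diag mulr0 add0r.
  by apply: eq_big => [j|j ij]; rewrite 1?eq_sym // coefmxE det_colsel2 // eq_sym.
rewrite !det_colsel1 => [|k|k]; rewrite ?xcol_eqE // !permE /= !xcol_eqE.
by rewrite [cominors P ucol _]cominorsC; ring.
Qed.

Definition system_pencil (S : MAsys F) : 'rV[F]_2 -> 'M[F]_(2 + 2 + 2) :=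
  pencil (bivector (sysF S)) (bivector (sysG S)).

Lemma inXE (S : MAsys F) P : 2%:R != 0 :> F ->
  inX S P <-> forall x, @pairing F 4 P (system_pencil S x) = 0.
Proof.
move=> two_neq0.
have pairing_bivector E : @pairing F 4 P (bivector E) = 2%:R * heval E P.
  by rewrite /bivector linearB /= pairing_tr opprK hevalE mulrDl mul1r.
have pairing_pencil x : @pairing F 4 P (system_pencil S x) =
    2%:R * (x 0 0 * heval (sysF S) P + x 0 1 * heval (sysG S) P).
  by rewrite linearD !linearZ /= !pairing_bivector; ring.
split=> [[F0 G0] x|P0]; first by rewrite pairing_pencil F0 G0 !mulr0 addr0 mulr0.
by split; apply: (mulfI two_neq0); rewrite mulr0;
  [rewrite -(P0 (delta_mx 0 0))|rewrite -(P0 (delta_mx 0 1))];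
  rewrite pairing_pencil !mxE /= !(mul1r, mul0r, add0r, addr0).
Qed.

End Bivectors.

Lemma congruent_SL_equiv (C : numClosedFieldType) (S1 S2 : MAsys C) :
  congruent (system_pencil S1) (system_pencil S2) -> SL_equiv S1 S2.
Proof.
move=> [g [h [gu hu S2E]]]; have two_neq0 : 2%:R != 0 :> C by rewrite pnatr_eq0.
pose c := 6.-root (\det g)^-1.
have c6 : c ^+ 6 * \det g = 1 by rewrite rootCK // mulVf // -unitfE -unitmxE.
have c2 : c ^+ 2 != 0.
  rewrite expf_eq0 /=; apply: contra_eq_neq c6 => ->.
  by rewrite expr0n mul0r eq_sym oner_neq0.
exists (c *: g)^T; split=> [|P _]; first by rewrite det_tr detZ.
rewrite !inXE //.
have pairing_transport x :
    c ^+ 2 * @pairing C 4 (P *m (c *: g)^T) (system_pencil S2 x) =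
    @pairing C 4 P (system_pencil S1 (x *m h)).
  rewrite -[RHS]mul1r -c6 -(@detZ C 6) -(@pairing_congr C 4) -linearZ /=.
  congr (pairing _ _); rewrite S2E [(c *: g)^T]linearZ /= -!scalemxAl -scalemxAr.
  by rewrite scalerA.
split=> P0 x; first by apply: (mulfI c2); rewrite pairing_transport P0 mulr0.
by rewrite -[x](mulmxKV hu) -pairing_transport P0 mulr0.
Qed.

(** * Reduction at a point of the system *)

Section PointReduction.

Variable F : fieldType.
Hypothesis two_neq0 : 2%:R != 0 :> F.
Implicit Types (E : MAeq F) (S : MAsys F) (u v : 'I_4 -> F).

Definition quadpart E : 'M[F]_(2 + 2) := quadcoef E - (quadcoef E)^T.

Definition gradmx E u v : 'M[F]_(2 + 2, 2) :=
  \matrix_(i, s) if s == 0 then dFv E u i else - dFu E v i.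

Definition jetmx u v : 'M[F]_(2 + 2, 2) := \matrix_(i, s) if s == 0 then u i else v i.

Definition graphmx u v : 'M[F]_(2 + 2 + 2) := block_mx 1%:M 0 (- (jetmx u v)^T) 1%:M.

Lemma graphmx_unit u v : graphmx u v \in unitmx.
Proof. by rewrite unitmxE det_lblock !det1 mulr1 unitr1. Qed.

Lemma tr_quadpart E : (quadpart E)^T = - quadpart E.
Proof. by rewrite linearB /= trmxK opprB. Qed.

Lemma aevalE E u v (U := jetmx u v)
    (W := U^T *m quadcoef E *m U - U^T *m lincoef E + ma_m E *: delta_mx 0 1) :
  aeval E u v = W 0 1 - W 1 0.
Proof.
have quadE s t : (U^T *m quadcoef E *m U) s t =
    \sum_i \sum_j ma_a E i j * (U i s * U j t).
  rewrite mxE exchange_big /=; apply: eq_bigr => j _; rewrite mxE mulr_suml.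
  by apply: eq_bigr => i _; rewrite !mxE; ring.
have linE s t : (U^T *m lincoef E) s t = \sum_i U i s * lincoef E i t.
  by rewrite mxE; apply: eq_bigr => i _; rewrite mxE.
have WE s t : W s t = \sum_i (\sum_j ma_a E i j * (U i s * U j t) - U i s * lincoef E i t)
    + ma_m E * ((s == 0) && (t == 1))%:R.
  by rewrite sumrB -quadE -linE !mxE.
rewrite !WE mulr1 mulr0 addr0 addrAC -sumrB /aeval -!big_split /=; congr (_ + _).
apply: eq_bigr => i _; have -> : U i 0 = u i by rewrite mxE.
have -> : U i 1 = v i by rewrite mxE.
have -> : \sum_j ma_a E i j * (u i * v j - u j * v i) =
    \sum_j ma_a E i j * (u i * U j 1) - \sum_j ma_a E i j * (v i * U j 0).
  by rewrite -sumrB; apply: eq_bigr => j _; rewrite !mxE /=; ring.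
by rewrite [lincoef E i 0]mxE [lincoef E i 1]mxE /=; ring.
Qed.

Lemma gradmxE E u v : gradmx E u v = lincoef E - quadpart E *m jetmx u v.
Proof.
apply/matrixP => i s; rewrite !mxE -sumrN addrC.
have -> : \sum_j - (quadpart E i j * jetmx u v j s) =
    \sum_j (ma_a E j i - ma_a E i j) * (if s == 0 then u j else v j).
  by apply: eq_bigr => j _; rewrite !mxE; ring.
case: (s == 0); rewrite /dFu /dFv // opprD -sumrN; congr (_ + _).
by apply: eq_bigr => j _; ring.
Qed.

Lemma coefmx_graph_congr E u v (U := jetmx u v) :
  graphmx u v *m coefmx E *m (graphmx u v)^T =
  block_mx (quadcoef E) (lincoef E - quadcoef E *m U) (- (U^T *m quadcoef E))
    (U^T *m quadcoef E *m U - U^T *m lincoef E + ma_m E *: delta_mx 0 1).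
Proof.
rewrite /graphmx /coefmx -/U tr_block_mx !mulmx_block trmx0 !trmx1 linearN /= trmxK.
rewrite !(mul0mx, mulmx0, mul1mx, mulmx1, addr0, add0r, mulmxN, mulNmx) opprK.
by rewrite [- _ + lincoef E]addrC addrA.
Qed.

Lemma bivector_graph_congr E u v : aeval E u v = 0 ->
  graphmx u v *m bivector E *m (graphmx u v)^T = bordermx (quadpart E) (gradmx E u v).
Proof.
move=> onE; rewrite /bivector (congr_sub_tr (graphmx u v)) coefmx_graph_congr.
have ur_block : lincoef E - quadcoef E *m jetmx u v
    - (- ((jetmx u v)^T *m quadcoef E))^T = gradmx E u v.
  by rewrite gradmxE mulmxBl opprD opprK linearN /= opprK trmx_mul trmxK addrA.
rewrite tr_block_mx opp_block_mx add_block_mx /bordermx -ur_block; congr block_mx.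
  by rewrite [in RHS]linearB /= trmxK opprD opprK addrC.
apply: skew_mx22_inj => //.
- by rewrite linearB /= trmxK opprB.
- by rewrite trmx0 oppr0.
by rewrite [RHS]mxE -onE aevalE [LHS]mxE ![(- _ ^T) _ _]mxE [(_^T) 0 1]mxE.
Qed.

Definition epsmx : 'M[F]_2 := delta_mx 0 1 - delta_mx 1 0.

Definition symbolmx S u v : 'M[F]_(2 + 2) :=
  row_mx (gradmx (sysF S) u v) (gradmx (sysG S) u v).

Definition regular_point S u v : Prop := onX S u v /\ symbolmx S u v \in unitmx.

Lemma chardetE S u v p : chardet S u v p =
  (\sum_i p i * dFu (sysF S) v i) * (\sum_i p i * dFv (sysG S) u i)
  - (\sum_i p i * dFv (sysF S) u i) * (\sum_i p i * dFu (sysG S) v i).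
Proof.
rewrite /chardet det_mx22 !summxE.
by congr (_ * _ - _ * _); apply: eq_bigr => i _; rewrite !mxE.
Qed.

Lemma polar_chardet S u v (gF := gradmx (sysF S) u v) (gG := gradmx (sysG S) u v) :
  polar (chardet S u v) = 2%:R^-1 *: (gF *m epsmx *m gG^T - gG *m epsmx *m gF^T).
Proof.
have sum1 i (f : 'I_4 -> F) : \sum_k basisv F i k * f k = f i.
  rewrite (bigD1 i) //= big1 ?addr0 /basisv ?eqxx ?mul1r // => k /negPf ->.
  by rewrite mul0r.
have sum2 i j (f : 'I_4 -> F) : \sum_k (basisv F i k + basisv F j k) * f k = f i + f j.
  by under eq_bigr do rewrite mulrDl; rewrite big_split !sum1.
apply/matrixP => i j; rewrite [LHS]mxE !chardetE !sum1 !sum2.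
by rewrite !(mxE, sum_ord2) /=; field.
Qed.

Lemma good_point_regular S u v : good_point S u v -> regular_point S u v.
Proof.
move=> [onS rank4]; split=> //; rewrite -row_full_unit -col_leq_rank -[leqLHS]rank4.
rewrite /quadric_rank polar_chardet -!mulmxA -mulmxN -mul_row_col scalemxAr.
exact: mxrankM_maxl.
Qed.

Definition normalized_quadpart S u v : 'rV[F]_2 -> 'M[F]_(2 + 2) :=
  mulmxr (invmx (symbolmx S u v))^T \o mulmx (invmx (symbolmx S u v))
    \o pencil (quadpart (sysF S)) (quadpart (sysG S)).

HB.instance Definition _ S u v := GRing.Linear.copy (normalized_quadpart S u v)
  (mulmxr (invmx (symbolmx S u v))^T \o mulmx (invmx (symbolmx S u v))
    \o pencil (quadpart (sysF S)) (quadpart (sysG S))).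

Lemma skew_normalized_quadpart S u v : skew_pencil (normalized_quadpart S u v).
Proof.
move=> x; rewrite !trmx_mul trmxK -mulNmx -mulmxN mulmxA; congr (_ *m _ *m _).
by rewrite linearD !linearZ /= !tr_quadpart !scalerN opprD.
Qed.

Lemma congruent_canonical_pencil S u v : regular_point S u v ->
  congruent (system_pencil S) (canonical_pencil (normalized_quadpart S u v)).
Proof.
move=> [[onF onG] symb]; pose L := invmx (symbolmx S u v).
pose Q := pencil (quadpart (sysF S)) (quadpart (sysG S)).
pose J := pencil (gradmx (sysF S) u v) (gradmx (sysG S) u v).
have graphE x : graphmx u v *m system_pencil S x *m (graphmx u v)^T = bordermx (Q x) (J x).
  rewrite -pencil_bordermx -!bivector_graph_congr // /system_pencil /pencil.
  by rewrite mulmxDr mulmxDl -!scalemxAr -!scalemxAl.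
have LJ x : L *m J x = stackmx 2 x.
  have [LF LG] : L *m gradmx (sysF S) u v = col_mx 1%:M 0 /\
                 L *m gradmx (sysG S) u v = col_mx 0 1%:M.
    apply: eq_row_mx; rewrite -mul_mx_row mulVmx //.
    by rewrite (@scalar_mx_block _ 2 2) block_mxEh.
  rewrite /J /pencil mulmxDr -!scalemxAr LF LG !scale_col_mx add_col_mx.
  by rewrite !scaler0 addr0 add0r !scale_scalar_mx !mulr1.
apply: (@congruent_trans _ _ (fun x => bordermx (Q x) (J x))).
  exists (graphmx u v), 1%:M; rewrite graphmx_unit unitmx1; split=> // x.
  by rewrite mulmx1 graphE.
apply: (@congruent_bordermx _ _ _ L 0 1%:M 1%:M) => [||//|x|x]; rewrite ?unitmx1 //.
- by rewrite unitmx_inv.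
- by rewrite mulmx1 trmx0 mulmx0 trmx0 subr0 addr0.
- by rewrite mulmx1 trmx1 mulmx1 LJ.
Qed.

Definition system_cubic S u v x : F := cubicmx (normalized_quadpart S u v) x 0 1.

Lemma system_cubicE S u v x (W : 'M_(2, 2 + 2)) :
    symbolmx S u v \in unitmx -> W *m symbolmx S u v = perpmx 2 x ->
  system_cubic S u v x =
    (W *m pencil (quadpart (sysF S)) (quadpart (sysG S)) x *m W^T) 0 1.
Proof.
move=> symb WE; have -> : W = perpmx 2 x *m invmx (symbolmx S u v).
  by rewrite -WE mulmxK.
by rewrite /system_cubic /cubicmx trmx_mul !mulmxA.
Qed.

Definition has_cubic S (f : 'rV[F]_2 -> F) : Prop :=
  exists u v, regular_point S u v /\ forall x, system_cubic S u v x = f x.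

Lemma has_cubic_congruent S1 S2 f1 f2 :
    has_cubic S1 f1 -> has_cubic S2 f2 -> cubic_equiv f1 f2 ->
  congruent (system_pencil S1) (system_pencil S2).
Proof.
move=> [u1 [v1 [reg1 cubic1]]] [u2 [v2 [reg2 cubic2]]] [k [h [k0 hu f1E]]].
apply: congruent_trans (congruent_canonical_pencil reg1) _; apply: congruent_sym.
apply: congruent_trans (congruent_canonical_pencil reg2) _.
have skewA S u v := @skew_normalized_quadpart S u v.
have skew_cubic S u v x := tr_cubicmx x (skewA S u v).
apply: (canonical_pencil_congruent two_neq0 (skewA _ _ _) (skewA _ _ _) k0 hu) => x.
apply: skew_mx22_inj => //.
- exact: skew_cubic.
- by rewrite linearZ /= skew_cubic scalerN.
by rewrite [RHS]mxE; have := f1E x; rewrite -cubic1 -cubic2.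
Qed.

End PointReduction.

(** * The normal forms *)

Section NormalForms.

Variable F : fieldType.
Hypothesis two_neq0 : 2%:R != 0 :> F.
Implicit Types (E : MAeq F) (S : MAsys F).
Notation eps := (epsmx F).

Lemma mulmx_epsmx : eps *m eps = - 1%:M.
Proof.
have id2 : 1%:M = delta_mx 0 0 + delta_mx 1 1 :> 'M[F]_2.
  by rewrite [1%:M]mx1_sum_delta sum_ord2.
rewrite mulmxBl !mulmxBr !mul_delta_mx !mul_delta_mx_0 // id2.
by rewrite sub0r subr0 opprD addrC.
Qed.

Lemma det_epsmx : \det eps = 1.
Proof. by rewrite det_mx22 !mxE /=; ring. Qed.

Lemma jetmx_cols (U : 'M[F]_(2 + 2, 2)) : jetmx (U^~ 0) (U^~ 1) = U.
Proof.
apply/matrixP => i s; rewrite mxE; case: eqVneq => [->//|s0].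
by congr (U _ _); case: s s0 => -[|[|//]] lt_s // _; apply: val_inj.
Qed.

Lemma system_cubic_block S u v a p q :
    quadpart (sysF S) = 0 -> gradmx (sysF S) u v = col_mx (- 1%:M) 0 ->
    quadpart (sysG S) = block_mx (p *: eps) 0 0 (q *: eps) ->
    gradmx (sysG S) u v = col_mx (- a *: eps) (- eps) ->
  symbolmx S u v \in unitmx /\
  forall x, system_cubic S u v x =
    x 0 1 * (p * x 0 1 ^+ 2 + q * (x 0 0 ^+ 2 + a ^+ 2 * x 0 1 ^+ 2)).
Proof.
move=> quadF gradF quadG gradG.
have symbolE : symbolmx S u v = block_mx (- 1%:M) (- a *: eps) 0 (- eps).
  by rewrite block_mxEh /symbolmx gradF gradG.
have symb : symbolmx S u v \in unitmx.
  rewrite symbolE unitmxE det_ublock -[- eps]scaleN1r detZ det_epsmx -scaleN1r.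
  by rewrite detZ det1 sqrrN expr1n !mulr1 unitr1.
split=> // x; pose W := row_mx (- x 0 1)%:M ((a * x 0 1)%:M - x 0 0 *: eps).
have W_symbol : W *m symbolmx S u v = perpmx 2 x.
  rewrite symbolE mul_row_block /perpmx mulmx0 addr0; congr row_mx.
    by rewrite mulmxN mulmx1 -raddfN /= opprK.
  rewrite mulmxBl !mul_scalar_mx -scalemxAl mulmxN mulmx_epsmx opprK !scalerN scalerA.
  by rewrite scalemx1 raddfN /= mulrNN mulrC addrA addrN add0r.
rewrite (system_cubicE symb W_symbol) quadF /pencil scaler0 add0r quadG scale_block_mx.
rewrite mul_row_block tr_row_mx mul_row_col.
by rewrite !(mxE, sum_ord2) /=; ring.
Qed.

Lemma quadcoef_eqA : quadcoef (eqA F) = 0.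
Proof. by apply/matrixP => i j; rewrite !mxE. Qed.

Lemma lincoef_eqA : lincoef (eqA F) = col_mx (- 1%:M) 0.
Proof.
by apply/matrixP => i s; case: (split_ordP i) => k ->; rewrite ?col_mxEu ?col_mxEd !mxE;
  case: k => -[|[|//]] ?; case: s => -[|[|//]] ?; rewrite /= /dlt /=; ring.
Qed.

Lemma has_cubic_block E p q a b x y :
    quadcoef E = block_mx (p *: delta_mx 0 1) 0 0 (q *: delta_mx 0 1) ->
    lincoef E = col_mx (- a *: eps) (- b *: eps) ->
    p * x ^+ 2 + q * y ^+ 2 + 2%:R * (a * x + b * y) + ma_m E = 0 -> b + q * y = 1 ->
  has_cubic (MASys (eqA F) E) (fun z =>
    z 0 1 * (p * z 0 1 ^+ 2 + q * (z 0 0 ^+ 2 + (a + p * x) ^+ 2 * z 0 1 ^+ 2))).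
Proof.
move=> quadE linE onE grad1; pose U : 'M[F]_(2 + 2, 2) := col_mx x%:M y%:M.
have quadpartE : quadpart E = block_mx (p *: eps) 0 0 (q *: eps).
  rewrite /quadpart quadE tr_block_mx opp_block_mx add_block_mx.
  by rewrite ![(_ *: _)^T]linearZ /= !trmx_delta trmx0 subrr -!scalerBr.
have quadpartA : quadpart (eqA F) = 0 by rewrite /quadpart quadcoef_eqA trmx0 subrr.
have gradA : gradmx (eqA F) (U^~ 0) (U^~ 1) = col_mx (- 1%:M) 0.
  by rewrite gradmxE quadpartA mul0mx subr0 lincoef_eqA.
have gradE : gradmx E (U^~ 0) (U^~ 1) = col_mx (- (a + p * x) *: eps) (- eps).
  rewrite gradmxE jetmx_cols quadpartE linE mul_block_col !mul0mx addr0 add0r.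
  rewrite !mul_mx_scalar opp_col_mx add_col_mx !scalerA -!scalerBl -[- eps]scaleN1r -grad1.
  by congr (col_mx (_ *: _) (_ *: _)); ring.
have [symb cubicE] := @system_cubic_block (MASys (eqA F) E) _ _ _ _ _
  quadpartA gradA quadpartE gradE.
exists (U^~ 0), (U^~ 1); split=> //; split=> //; split; rewrite aevalE jetmx_cols.
  rewrite quadcoef_eqA lincoef_eqA mulmx0 mul0mx sub0r tr_col_mx mul_row_col mulmx0.
  by rewrite addr0 !tr_scalar_mx !(mxE, sum_ord2) /=; ring.
rewrite quadE linE tr_col_mx mul_row_block !mul_row_col.
by rewrite !(mxE, sum_ord2) /= -onE; ring.
Qed.

Lemma quadcoef_z2 b c m : quadcoef (MAEq (z2 F) b c m) = 0.
Proof. by apply/matrixP => i j; rewrite !mxE. Qed.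

Lemma quadcoef_delta (k l : 'I_(2 + 2)) b c m :
  quadcoef (MAEq (fun i j => dlt F i k * dlt F j l) b c m) = delta_mx k l.
Proof. by apply/matrixP => i j; rewrite !mxE /= -natrM mulnb. Qed.

Lemma lincoef_z1 a m : lincoef (MAEq a (z1 F) (z1 F) m) = 0.
Proof. by apply/matrixP => i s; rewrite !mxE oppr0 if_same. Qed.

Lemma lincoef_delta a m (k l : 'I_(2 + 2)) :
  lincoef (MAEq a (fun i => dlt F i k) (fun i => dlt F i l) m)
    = delta_mx l 0 - delta_mx k 1.
Proof.
apply/matrixP => i s; rewrite !mxE /= /dlt.
by case: s => -[|[|//]] ?; rewrite /= ?andbT ?andbF ?subr0 ?sub0r.
Qed.

Lemma lincoef_delta_upper a m :
  lincoef (MAEq a (fun i => dlt F i 0) (fun i => dlt F i 1) m) = col_mx (- eps) 0.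
Proof.
apply: etrans (lincoef_delta _ _ (lshift 2 0) (lshift 2 1)) _.
by rewrite !delta_mx_ushift opp_col_mx add_col_mx subr0 opprB.
Qed.

Lemma lincoef_delta_lower a m :
  lincoef (MAEq a (fun i => dlt F i 2) (fun i => dlt F i 3) m) = col_mx 0 (- eps).
Proof.
apply: etrans (lincoef_delta _ _ (rshift 2 0) (rshift 2 1)) _.
by rewrite !delta_mx_dshift opp_col_mx add_col_mx subr0 opprB.
Qed.

Lemma quadcoef_delta_upper b c m :
  quadcoef (MAEq (fun i j => dlt F i 0 * dlt F j 1) b c m)
    = block_mx (delta_mx 0 1) 0 0 0.
Proof.
apply: etrans (quadcoef_delta (lshift 2 0) (lshift 2 1) _ _ _) _.
by rewrite delta_mx_lshift delta_mx_ushift block_mxEh col_mx0.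
Qed.

Lemma quadcoef_delta_lower b c m :
  quadcoef (MAEq (fun i j => dlt F i 2 * dlt F j 3) b c m)
    = block_mx 0 0 0 (delta_mx 0 1).
Proof.
apply: etrans (quadcoef_delta (rshift 2 0) (rshift 2 1) _ _ _) _.
by rewrite delta_mx_rshift delta_mx_dshift block_mxEh col_mx0.
Qed.

Lemma has_cubic_ext S f g : f =1 g -> has_cubic S f -> has_cubic S g.
Proof.
by move=> fg [u [v [reg cubicE]]]; exists u, v; split=> // x; rewrite cubicE fg.
Qed.

Lemma NF1_cubic : has_cubic (NF1 F) (fun=> 0).
Proof.
apply: has_cubic_ext (@has_cubic_block _ 0 0 0 1 0 0 _ _ _ _) => [x|||/=|]; try by ring.
- by rewrite quadcoef_z2 scale0r block_mx0.
- by rewrite lincoef_delta_lower oppr0 scale0r scaleN1r.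
Qed.

Lemma NF2_cubic : has_cubic (NF2 F) (@triple_root_cubic F).
Proof.
apply: has_cubic_ext (@has_cubic_block _ 1 0 0 1 0 0 _ _ _ _) => [x|||/=|];
  rewrite /triple_root_cubic; try by ring.
- by rewrite quadcoef_delta_upper scale1r scale0r.
- by rewrite lincoef_delta_lower oppr0 scale0r scaleN1r.
Qed.

Lemma NF3_cubic : has_cubic (NF3 F) (@double_root_cubic F).
Proof.
apply: has_cubic_ext (@has_cubic_block _ 0 1 0 0 0 1 _ _ _ _) => [x|||/=|];
  rewrite /double_root_cubic; try by ring.
- by rewrite quadcoef_delta_lower scale1r scale0r.
- by rewrite lincoef_z1 oppr0 scale0r col_mx0.
Qed.

Lemma NF4_cubic : has_cubic (NF4 F) (@simple_roots_cubic F).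
Proof.
apply: has_cubic_ext (@has_cubic_block _ 0 1 1 0 (- 2%:R^-1) 1 _ _ _ _) => [x|||/=|];
  rewrite /simple_roots_cubic; try by field.
- by rewrite quadcoef_delta_lower scale1r scale0r.
- by rewrite lincoef_delta_upper oppr0 scale0r scaleN1r.
Qed.

End NormalForms.

Theorem theorem2 (C : numClosedFieldType) (S : MAsys C) :
  lin_indep S -> MA_nondegenerate S ->
  SL_equiv S (NF1 C) \/ SL_equiv S (NF2 C) \/
  SL_equiv S (NF3 C) \/ SL_equiv S (NF4 C).
Proof.
have two_neq0 : 2%:R != 0 :> C by rewrite pnatr_eq0.
move=> _ [[u [v /(good_point_regular two_neq0) regular_uv]] _].
have [a [b [c cubicE]]] := cubicmx_split (normalized_quadpart S u v) 0 1.
have cubicS : has_cubic S (linform_prod a b c) by exists u, v.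
have SL_equiv_of_cubic S' f :
    cubic_equiv (linform_prod a b c) f -> has_cubic S' f -> SL_equiv S S'.
  move=> equiv_f cubicS'; apply: congruent_SL_equiv.
  exact: has_cubic_congruent cubicS cubicS' equiv_f.
case: (linform_prod_classification two_neq0 a b c) => /SL_equiv_of_cubic equiv_NF.
- by left; apply: equiv_NF; apply: NF1_cubic.
- by right; left; apply: equiv_NF; apply: NF2_cubic.
- by right; right; left; apply: equiv_NF; apply: NF3_cubic.
- by right; right; right; apply: equiv_NF; apply: NF4_cubic.
Qed.
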